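(* Consider a packing-type two-stage stochastic problem with $k\ge1$ realizations, and let $z^{N.S.}$ be the optimal objective value obtained after adding all specific-scenario cuts to the linear programming relaxation. Then $$z^{N.S.}\le\left(\frac{2k-1}{k}\right)z^I .$$ Moreover this bound is tight: for every $k\ge1$ and every $\epsilon>0$ there is a packing-type two-stage stochastic problem with $k$ realizations and $z^I>0$ such that $z^{N.S.}\ge\left(\frac{2k-1}{k}-\epsilon\right)z^I$.
   Context: A packing-type two-stage stochastic problem with $k$ realizations is a mixed integer linear program of the form $$\max\ c^Ty+\sum_{i=1}^k(d^i)^Tz^i\quad\text{s.t.}\quad Ay\le b,\qquad A^iy+B^iz^i\le b^i\ \ (i=1,\dots,k),$$ where $y$ is the vector of first-stage variables, $z^i$ is the vector of second-stage variables of realization $i$, all variables are nonnegative, a specified subset of the variables is required to be integer, and all matrices, right-hand sides and objective vectors have nonnegative rational entries. Let $P$ be the feasible region, $P^I$ its convex hull, $P^{LP}$ the feasible region of the linear programming relaxation, and $z^I$ the maximum of the objective over $P^I$. A specific-scenario cut is a linear inequality valid for $P^I$ whose coefficients are zero outside the variables $(y,z^i)$ for some single $i\in\{1,\dots,k\}$. $z^{N.S.}$ is the maximum of the objective over the points of $P^{LP}$ that satisfy all specific-scenario cuts. *)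

(* Defs.v *)
From HB Require Import structures.
From mathcomp Require Import all_boot all_order all_algebra.
From mathcomp Require Import all_classical all_reals all_analysis.
Set Implicit Arguments.
Unset Strict Implicit.
Unset Printing Implicit Defensive.
Import Order.TTheory GRing.Theory Num.Theory.
Local Open Scope classical_set_scope.
Local Open Scope ring_scope.

(* Dimensions may depend on the realization; realizations are indexed from 0. *)
Record packing_problem (k : nat) := PackingProblem {
  dim1 : nat;
  dim2 : 'I_k -> nat;
  rows1 : nat;
  rows2 : 'I_k -> nat;
  mxA : 'M[rat]_(rows1, dim1);
  rhs1 : 'cV[rat]_rows1;
  mxA2 : forall i, 'M[rat]_(rows2 i, dim1);
  mxB2 : forall i, 'M[rat]_(rows2 i, dim2 i);
  rhs2 : forall i, 'cV[rat]_(rows2 i);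
  cost1 : 'cV[rat]_dim1;
  cost2 : forall i, 'cV[rat]_(dim2 i);
  int1 : {set 'I_dim1};
  int2 : forall i, {set 'I_(dim2 i)};
  mxA_ge0 : mxA \is a mxOver Num.nneg;
  rhs1_ge0 : rhs1 \is a mxOver Num.nneg;
  mxA2_ge0 : forall i, mxA2 i \is a mxOver Num.nneg;
  mxB2_ge0 : forall i, mxB2 i \is a mxOver Num.nneg;
  rhs2_ge0 : forall i, rhs2 i \is a mxOver Num.nneg;
  cost1_ge0 : cost1 \is a mxOver Num.nneg;
  cost2_ge0 : forall i, cost2 i \is a mxOver Num.nneg }.

Definition lemx (R : numDomainType) m n (u v : 'M[R]_(m, n)) : Prop :=
  forall i j, u i j <= v i j.

Definition dotc (R : nzRingType) n (u v : 'cV[R]_n) : R :=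
  \sum_(j < n) u j 0 * v j 0.

Definition ratmx (R : realType) m n (M : 'M[rat]_(m, n)) : 'M[R]_(m, n) :=
  map_mx ratr M.

Definition convex_hull (R : realType) (E : lmodType R) (S : set E) : set E :=
  smallest (@convex_set R E) S.

Section Packing.
Variables (R : realType) (k : nat) (Q : packing_problem k).

(* A pair (y, z), where z stacks z^0, ..., z^(k-1); also used for vectors of
   coefficients on (y, z). *)
Local Notation point :=
  ('cV[R]_(dim1 Q) * 'cV[R]_(\sum_(i < k) dim2 Q i))%type.

Definition stage1 (x : point) : 'cV[R]_(dim1 Q) := x.1.
Definition stage2 (x : point) (i : 'I_k) : 'cV[R]_(dim2 Q i) := submxcol x.2 i.

Definition linform (a x : point) : R :=
  dotc (stage1 a) (stage1 x) + \sum_(i < k) dotc (stage2 a i) (stage2 x i).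

Definition objective (x : point) : R :=
  dotc (ratmx R (cost1 Q)) (stage1 x)
  + \sum_(i < k) dotc (ratmx R (cost2 Q i)) (stage2 x i).

Definition lp_feasible : set point := [set x |
  [/\ lemx 0 (stage1 x), (forall i, lemx 0 (stage2 x i)),
      lemx (ratmx R (mxA Q) *m stage1 x) (ratmx R (rhs1 Q))
    & forall i, lemx (ratmx R (mxA2 Q i) *m stage1 x
                      + ratmx R (mxB2 Q i) *m stage2 x i)
                     (ratmx R (rhs2 Q i))]].

Definition integral : set point := [set x |
  (forall j, j \in int1 Q -> stage1 x j 0 \is a Num.int) /\
  (forall i j, j \in int2 Q i -> stage2 x i j 0 \is a Num.int)].

Definition feasible : set point := lp_feasible `&` integral.

Definition integer_hull : set point :=
  convex_hull feasible.

(* The inequality [linform a x <= beta]. *)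
Definition specific_scenario_cut (a : point) (beta : R) : Prop :=
  (forall x, integer_hull x -> linform a x <= beta) /\
  (exists i, forall j, j != i -> stage2 a j = 0).

Definition specific_scenario_closure : set point := [set x |
  lp_feasible x /\
  forall a beta, specific_scenario_cut a beta -> linform a x <= beta].

(* The optimal value is a supremum in the extended reals, so that it is defined
   (as +oo) for unbounded problems too; it is the maximum when [attained]. *)
Definition optval (S : set point) : \bar R :=
  ereal_sup [set (objective x)%:E | x in S].

Definition attained (S : set point) : Prop :=
  exists2 x, S x & optval S = (objective x)%:E.

Definition zI : \bar R := optval integer_hull.
Definition zNS : \bar R := optval specific_scenario_closure.

End Packing.

Arguments lp_feasible R {k} Q _.
Arguments integral R {k} Q _.
Arguments feasible R {k} Q _.
Arguments integer_hull R {k} Q _.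
Arguments specific_scenario_closure R {k} Q _.

(* Main.v *)
Require Import Defs.
From mathcomp Require Import all_boot all_order all_algebra.
From mathcomp Require Import all_classical all_reals all_analysis.
From mathcomp Require Import ring lra.
Set Implicit Arguments.
Unset Strict Implicit.
Unset Printing Implicit Defensive.
Import Order.TTheory GRing.Theory Num.Theory.
Local Open Scope ring_scope.

(* Upper bound: write [c] and [d^i] for the costs of the two stages. Setting
   variables to 0 preserves feasibility, so [c y + d^i z^i <= z^I] is valid for
   every [i]; and feasible choices of the [z^i] can be glued together at [y = 0],
   so the maxima [D_i] of [d^i z^i] satisfy [\sum_i D_i <= z^I]. Adding the [k] cuts
   of the first kind to [k - 1] times the sum of the cuts [d^i z^i <= D_i] bounds
   [k] times the objective by [(2k - 1) z^I].

   Tightness: take [y] indexed by the points of the affine plane over [F_p] with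
   [p >= k], and [k] parallel classes of lines, where [z_i = 1] requires the support
   of [y] to lie on one line of class [i]. A line carries total cost [k - 1] and each
   [z_i] pays 1. Two lines of different classes meet in one point, so
   [z^I = k + (k - 1) / p], whereas [y = 1 / p], [z = 1] has value [2k - 1] and for
   every single [i] is an average of lines of class [i]. *)

(** * Inner products and entrywise nonnegative matrices *)

Lemma dotcDr (R : nzRingType) n (u v w : 'cV[R]_n) :
  dotc u (v + w) = dotc u v + dotc u w.
Proof. by rewrite /dotc -big_split; apply: eq_bigr => j _; rewrite mxE mulrDr. Qed.

Lemma dotcZr (R : comNzRingType) n (u v : 'cV[R]_n) (t : R) :
  dotc u (t *: v) = t * dotc u v.
Proof. by rewrite /dotc mulr_sumr; apply: eq_bigr => j _; rewrite mxE mulrCA. Qed.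

Lemma dotc0l (R : nzRingType) n (v : 'cV[R]_n) : dotc 0 v = 0.
Proof. by apply: big1 => j _; rewrite mxE mul0r. Qed.

Lemma dotc0r (R : nzRingType) n (u : 'cV[R]_n) : dotc u 0 = 0.
Proof. by apply: big1 => j _; rewrite mxE mulr0. Qed.

Lemma dotc_ge0 (R : numDomainType) n (u v : 'cV[R]_n) :
  lemx 0 u -> lemx 0 v -> 0 <= dotc u v.
Proof.
move=> u0 v0; apply: sumr_ge0 => j _.
by apply: mulr_ge0; [have := u0 j 0 | have := v0 j 0]; rewrite mxE.
Qed.

Lemma sum_enum_val (V : nmodType) (T : finType) (f : T -> V) :
  \sum_(j < #|T|) f (enum_val j) = \sum_u f u.
Proof. by rewrite -big_enum_val. Qed.

Lemma const_mx_nneg (F : numDomainType) m n (a : F) :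
  0 <= a -> (const_mx a : 'M[F]_(m, n)) \is a mxOver Num.nneg.
Proof. by move=> a0; apply/mxOverP => i j; rewrite mxE. Qed.

Lemma ratmx_ge0 (R : realType) m n (M : 'M[rat]_(m, n)) :
  M \is a mxOver Num.nneg -> lemx 0 (ratmx R M).
Proof. by move=> /mxOverP M0 i j; rewrite !mxE ler0q; have := M0 i j. Qed.

Lemma mulmx_ge0 (R : numDomainType) m n (M : 'M[R]_(m, n)) (v : 'cV[R]_n) :
  lemx 0 M -> lemx 0 v -> lemx 0 (M *m v).
Proof.
move=> M0 v0 i j; rewrite !mxE; apply: sumr_ge0 => l _.
by apply: mulr_ge0; [have := M0 i l | have := v0 l j]; rewrite mxE.
Qed.

(** * Linear forms, cuts and feasible points of a general packing problem *)

Section PackingTheory.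
Variables (R : realType) (k : nat) (Q : packing_problem k).
Local Notation point :=
  ('cV[R]_(dim1 Q) * 'cV[R]_(\sum_(i < k) dim2 Q i))%type.

Definition mkpoint (y : 'cV[R]_(dim1 Q)) (z : forall i, 'cV[R]_(dim2 Q i)) :
  point := (y, \mxcol_i z i).

Lemma stage1_mk y z : stage1 (mkpoint y z) = y.
Proof. by []. Qed.

Lemma stage2_mk y z i : stage2 (mkpoint y z) i = z i.
Proof. exact: mxcolK. Qed.

Lemma stage2_comb (x y : point) (s t : R) i :
  stage2 (s *: x + t *: y) i = s *: stage2 x i + t *: stage2 y i.
Proof. by apply/matrixP => p q; rewrite !mxE. Qed.

Lemma linform_comb (a x y : point) (s t : R) :
  linform a (s *: x + t *: y) = s * linform a x + t * linform a y.
Proof.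
have -> : linform a (s *: x + t *: y) = s * dotc (stage1 a) (stage1 x) +
    t * dotc (stage1 a) (stage1 y) + \sum_(i < k)
    (s * dotc (stage2 a i) (stage2 x i) + t * dotc (stage2 a i) (stage2 y i)).
  congr (_ + _); first by rewrite dotcDr !dotcZr.
  by apply: eq_bigr => i _; rewrite stage2_comb dotcDr !dotcZr.
by rewrite big_split /= -!mulr_sumr /linform; ring.
Qed.

Definition cost : point :=
  mkpoint (ratmx R (cost1 Q)) (fun i => ratmx R (cost2 Q i)).

Lemma objectiveE (x : point) : objective x = linform cost x.
Proof.
by rewrite /objective /linform; congr (_ + _); apply: eq_bigr => i _; rewrite stage2_mk.
Qed.

Lemma feasible_hull (x : point) : feasible R Q x -> integer_hull R Q x.
Proof. exact: sub_gen_smallest. Qed.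

(** A half-space is convex, so it contains the smallest convex set around any points that it
    contains. *)
Lemma hull_linform_le (a : point) (b : R) :
  (forall x, feasible R Q x -> linform a x <= b) ->
  forall x, integer_hull R Q x -> linform a x <= b.
Proof.
move=> H; apply: (@smallest_sub _ _ _ [set x | linform a x <= b]%classic) => //.
move=> x y l; rewrite !inE /= => Hx Hy.
have -> : conv l x y = l%:num *: (x : point) + (1 - l%:num) *: (y : point) by [].
rewrite linform_comb.
have l0 : 0 <= l%:num by [].
have l1 : l%:num <= 1 by [].
by move: (l%:num) l0 l1 => t t0 t1; nra.
Qed.

Lemma feasible_cut_le (a : point) (b : R) (i : 'I_k) (x : point) :
  (forall j, j != i -> stage2 a j = 0) ->
  (forall x, feasible R Q x -> linform a x <= b) ->
  specific_scenario_closure R Q x -> linform a x <= b.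
Proof.
move=> Ha H [_]; apply; split; last by exists i.
exact: hull_linform_le.
Qed.

Lemma feasible0 : feasible R Q (mkpoint 0 (fun=> 0)).
Proof.
split; split.
- by move=> j l; rewrite mxE.
- by move=> i j l; rewrite stage2_mk.
- by rewrite stage1_mk mulmx0; apply/ratmx_ge0/rhs1_ge0.
- by move=> i; rewrite stage1_mk stage2_mk !mulmx0 addr0; apply/ratmx_ge0/rhs2_ge0.
- by move=> j _; rewrite mxE int_num0.
- by move=> i j _; rewrite stage2_mk mxE int_num0.
Qed.

(** At $y = 0$ the realizations no longer interact, and dropping the nonnegative term $A^i y$ only
    loosens the rows of realization $i$. *)
Lemma feasible_glue (p : 'I_k -> point) :
  (forall i, feasible R Q (p i)) ->
  feasible R Q (mkpoint 0 (fun i => stage2 (p i) i)).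
Proof.
move=> Fp; have [[_ _ A0 _] [I1 _]] := feasible0.
split; split => //.
- by move=> i; rewrite stage2_mk; have [[]] := Fp i.
- move=> i r c; rewrite stage1_mk stage2_mk mulmx0 add0r.
  have [[y0 _ _ Bi] _] := Fp i; apply: le_trans (Bi i r c).
  rewrite [leRHS]mxE lerDr.
  have := mulmx_ge0 (ratmx_ge0 R (mxA2_ge0 Q i)) y0 r c.
  by rewrite [leLHS]mxE.
- by move=> i j jI; rewrite stage2_mk; have [_ [_]] := Fp i; apply.
Qed.

(** Since $B^j \ge 0$, replacing $z^j$ by 0 can only decrease the left-hand sides, and 0 is an
    integer. *)
Lemma feasible_restrict (x : point) (i : 'I_k) :
  feasible R Q x ->
  feasible R Q (mkpoint (stage1 x) (fun j => if j == i then stage2 x j else 0)).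
Proof.
move=> [[y0 z0 A0 B0] [I1 I2]]; split; split => //.
- by move=> j; rewrite stage2_mk; case: eqP => _ // r c; rewrite mxE.
- move=> j; rewrite stage1_mk stage2_mk; case: eqP => // _ r c.
  rewrite mulmx0 addr0; apply: le_trans (B0 j r c).
  rewrite [leRHS]mxE lerDl.
  have := mulmx_ge0 (ratmx_ge0 R (mxB2_ge0 Q j)) (z0 j) r c.
  by rewrite [leLHS]mxE.
- move=> j l lI; rewrite stage2_mk; case: eqP => _; first exact: I2.
  by rewrite mxE int_num0.
Qed.

Lemma scenario_linform (c : 'cV[R]_(dim1 Q)) (d : forall i, 'cV[R]_(dim2 Q i)) i x :
  linform (mkpoint c (fun j => if j == i then d j else 0)) x =
  dotc c (stage1 x) + dotc (d i) (stage2 x i).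
Proof.
rewrite /linform stage1_mk (bigD1 i) //= stage2_mk eqxx big1 ?addr0 // => j ji.
by rewrite stage2_mk (negPf ji) dotc0l.
Qed.

(** Both families of cuts in the upper bound have this form: [c] is the first-stage cost in one and
    0 in the other. *)
Lemma closure_scenario_le (c : 'cV[R]_(dim1 Q)) (d : forall i, 'cV[R]_(dim2 Q i)) i b x :
  (forall x, feasible R Q x -> dotc c (stage1 x) + dotc (d i) (stage2 x i) <= b) ->
  specific_scenario_closure R Q x -> dotc c (stage1 x) + dotc (d i) (stage2 x i) <= b.
Proof.
move=> H; rewrite -scenario_linform; apply: (@feasible_cut_le _ _ i).
  by move=> j ji; rewrite stage2_mk (negPf ji).
by move=> {}x; rewrite scenario_linform; apply: H.
Qed.

(** * The upper bound for a finite value *)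

Local Notation c1 := (ratmx R (cost1 Q)).
Local Notation d2 i := (ratmx R (cost2 Q i)).

Lemma closure_objective_le (v : R) x :
  (0 < k)%N -> (forall x, feasible R Q x -> objective x <= v) ->
  specific_scenario_closure R Q x ->
  objective x <= (2 * k%:R - 1) / k%:R * v.
Proof.
move=> k0 Hv Hx.
have c0 : lemx 0 c1 by exact/ratmx_ge0/cost1_ge0.
have cut i : dotc c1 (stage1 x) + dotc (d2 i) (stage2 x i) <= v.
  apply: (closure_scenario_le (d := fun i => d2 i)) Hx => {}x /(feasible_restrict i)/Hv.
  rewrite /objective stage1_mk (bigD1 i) //= stage2_mk eqxx big1 ?addr0 //.
  by move=> j ji; rewrite stage2_mk (negPf ji) dotc0r.
(* $D_i$ is taken as the supremum of [E i], so that no maximizer has to be exhibited. *)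
pose E i := [set dotc (d2 i) (stage2 x i) | x in feasible R Q]%classic.
have supE i : has_sup (E i).
  split.
    have F0 := feasible0.
    by eexists; exists (mkpoint 0 (fun=> 0)).
  exists v => _ [y Fy <-].
  apply: le_trans (Hv _ (feasible_restrict i Fy)).
  rewrite /objective stage1_mk (bigD1 i) //= stage2_mk eqxx big1 ?addr0 => [|j ji].
    by rewrite lerDr; apply: dotc_ge0 => //; case: Fy => -[].
  by rewrite stage2_mk (negPf ji) dotc0r.
have zcut i : dotc (d2 i) (stage2 x i) <= sup (E i).
  rewrite -[leLHS]add0r -(dotc0l (stage1 x)).
  apply: (closure_scenario_le (d := fun i => d2 i)) Hx => y Fy; rewrite dotc0l add0r.
  by apply: (ub_le_sup (proj2 (supE i))); exists y.
have sumE : \sum_(i < k) sup (E i) <= v.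
  (* Each realization gets a feasible point within $e/k$ of its supremum; gluing these points loses
     at most $e$ in total. *)
  apply/ler_addgt0Pr => e e0.
  have ek0 : 0 < e / k%:R by rewrite divr_gt0 ?ltr0n.
  have /choice[p Hp] : forall i, exists y, feasible R Q y /\
      sup (E i) - e / k%:R < dotc (d2 i) (stage2 y i).
    by move=> i; have [_ [y Fy <-] ?] := sup_adherent ek0 (supE i); exists y.
  have := Hv _ (feasible_glue (fun i => proj1 (Hp i))).
  rewrite /objective stage1_mk dotc0r add0r -lerBlDr; apply: le_trans.
  have -> : e = \sum_(i < k) e / k%:R.
    by rewrite sumr_const card_ord -[RHS]mulr_natr divfK // pnatr_eq0 -lt0n.
  rewrite -sumrB; apply: ler_sum => i _; rewrite stage2_mk.
  exact/ltW/(proj2 (Hp i)).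
have sumz : \sum_(i < k) dotc (d2 i) (stage2 x i) <= v.
  by apply: le_trans sumE; apply: ler_sum.
have sumc : k%:R * dotc c1 (stage1 x) + \sum_(i < k) dotc (d2 i) (stage2 x i) <= k%:R * v.
  have -> r : k%:R * r = \sum_(i < k) r by rewrite sumr_const card_ord mulr_natl.
  have -> : k%:R * v = \sum_(i < k) v by rewrite sumr_const card_ord mulr_natl.
  by rewrite -big_split /=; apply: ler_sum.
have kR : 1 <= k%:R :> R by rewrite ler1n.
rewrite mulrAC ler_pdivlMr ?ltr0n // /objective.
(* $k(s + t) = (ks + t) + (k - 1)t \le kv + (k - 1)v$. *)
by move: (dotc c1 _) (\sum_(i < k) _) sumz sumc => s t; nra.
Qed.

(** * Optimal values in the extended reals *)

Lemma optval_le (S : set point) (b : R) :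
  (forall x, S x -> objective x <= b) -> (optval S <= b%:E)%E.
Proof. by move=> H; apply: ge_ereal_sup => _ [x Sx <-]; rewrite lee_fin H. Qed.

Lemma optval_ge (S : set point) x : S x -> ((objective x)%:E <= optval S)%E.
Proof. by move=> Sx; apply: ereal_sup_ubound; exists x. Qed.

Lemma optval_max (S : set point) x :
  S x -> (forall y, S y -> objective y <= objective x) ->
  optval S = (objective x)%:E.
Proof. by move=> Sx H; apply/le_anti; rewrite optval_le ?optval_ge. Qed.

(** If $z^I = +\infty$ the bound is trivial because the factor is positive; $-\infty$ is excluded
    because the origin is feasible. *)
Lemma zNS_le : (0 < k)%N ->
  (zNS R Q <= ((2 * k%:R - 1) / k%:R)%:E * zI R Q)%E.
Proof.
move=> k0; have kR : 1 <= k%:R :> R by rewrite ler1n.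
have zI_ge x : feasible R Q x -> ((objective x)%:E <= zI R Q)%E.
  by move=> /feasible_hull; apply: optval_ge.
case E : (zI R Q) => [v||].
- apply: optval_le => x; apply: closure_objective_le => // y /zI_ge.
  by rewrite E lee_fin.
- by rewrite gt0_muley ?leey // lte_fin divr_gt0 ?ltr0n //; lra.
- by have := zI_ge _ feasible0; rewrite E.
Qed.

End PackingTheory.

(** * Parallel classes of lines in the affine plane over $F_p$ *)

Section TightExample.
Variables (R : realType) (k p : nat).
Hypotheses (k_gt0 : (0 < k)%N) (p_prime : prime p) (le_kp : (k <= p)%N).

Local Notation plane := ('F_p * 'F_p)%type.

(** The lines of class [i] are the level sets of this function, that is, the lines of slope $-i$. *)
Definition line_class (i : 'I_k) (u : plane) : 'F_p := u.2 + i%:R * u.1.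

Lemma line_class_inj i j u v : i != j ->
  line_class i u = line_class i v -> line_class j u = line_class j v -> u = v.
Proof.
case: u v => [x y] [x' y']; rewrite /line_class /= => ij ei ej.
have Fij : (i%:R : 'F_p) - j%:R != 0.
  rewrite subr_eq0; apply: contra ij => /eqP/(congr1 val)/=.
  (* As $k \le p$, the indices are below $p$, so distinct classes have distinct slopes modulo
     $p$. *)
  rewrite !val_Fp_nat // !modn_small ?(leq_trans (ltn_ord _)) // => ij.
  exact/eqP/val_inj.
have /eqP : (i%:R - j%:R) * (x - x') = 0.
  have -> : (i%:R - j%:R) * (x - x') =
    (y + i%:R * x) - (y + j%:R * x) - ((y' + i%:R * x') - (y' + j%:R * x')) by ring.
  by rewrite ei ej subrr.
rewrite mulf_eq0 (negPf Fij) subr_eq0 => /eqP xx'; move: ei.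
by rewrite xx' => /addIr ->.
Qed.

(** A line that is not vertical has exactly one point for each abscissa. *)
Lemma sum_line_class i c : \sum_u (line_class i u == c)%:R = p%:R :> R.
Proof.
transitivity (\sum_(x : 'F_p) \sum_(y : 'F_p) (y + i%:R * x == c)%:R : R).
  by rewrite pair_big.
have H x : \sum_(y : 'F_p) (y + i%:R * x == c)%:R = 1 :> R.
  rewrite (bigD1 (c - i%:R * x)) //= subrK eqxx big1 ?addr0 // => y.
  by rewrite eq_sym subr_eq eq_sym => /negPf ->.
by under eq_bigr do rewrite H; rewrite sumr_const card_Fp.
Qed.

Lemma card_plane : #|{: plane}| = (p * p)%N.
Proof. by rewrite card_prod card_Fp. Qed.

(** * The extremal problem and its constraints in terms of points of the plane *)

Definition tight_mxA2 (i : 'I_k) : 'M[rat]_(#|{: plane * plane}|, #|{: plane}|) :=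
  \matrix_(r, j) ((line_class i (enum_val r).1 != line_class i (enum_val r).2) &&
    ((enum_val j == (enum_val r).1) || (enum_val j == (enum_val r).2)))%:R.

Definition tight_rhs2 (i : 'I_k) : 'cV[rat]_(#|{: plane * plane}|) :=
  \col_r (1 + (line_class i (enum_val r).1 != line_class i (enum_val r).2)%:R).

Lemma tight_mxA2_nneg i : tight_mxA2 i \is a mxOver Num.nneg.
Proof. by apply/mxOverP => r j; rewrite mxE nnegrE ler0n. Qed.

Lemma tight_rhs2_nneg i : tight_rhs2 i \is a mxOver Num.nneg.
Proof. by apply/mxOverP => r j; rewrite mxE nnegrE addr_ge0 ?ler0n. Qed.

Lemma tight_cost_ge0 : 0 <= k.-1%:R / p%:R :> rat.
Proof. by rewrite divr_ge0 ?ler0n. Qed.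

(* The first stage asks [\sum_u y_u <= p]. The row [(u, v)] of realization [i] is
   [y_u + y_v + z_i <= 2] if [u] and [v] lie on different lines of class [i], and
   [z_i <= 1] otherwise, so that [z_i = 1] forces an integral [y] onto one line. *)
Definition tight_problem : packing_problem k :=
  @PackingProblem k #|{: plane}| (fun=> 1%N) 1%N (fun=> #|{: plane * plane}|)
    (const_mx 1) (const_mx p%:R) tight_mxA2 (fun=> const_mx 1) tight_rhs2
    (const_mx (k.-1%:R / p%:R)) (fun=> const_mx 1) [set: _] (fun=> [set: _])
    (const_mx_nneg _ _ ler01) (const_mx_nneg _ _ (ler0n _ _))
    tight_mxA2_nneg (fun=> const_mx_nneg _ _ ler01) tight_rhs2_nneg
    (const_mx_nneg _ _ tight_cost_ge0) (fun=> const_mx_nneg _ _ ler01).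

Local Notation Q := tight_problem.
Local Notation point :=
  ('cV[R]_(dim1 Q) * 'cV[R]_(\sum_(i < k) dim2 Q i))%type.

(** [weight] and [level] are coordinates $y_u$ and $z_i$ that hide the enumeration of the plane and
    the one-row vectors of the second stage. *)
Definition weight (x : point) (u : plane) : R :=
  (stage1 x : 'cV_#|{: plane}|) (enum_rank u) 0.
Definition level (x : point) (i : 'I_k) : R := (stage2 x i : 'cV_1) 0 0.

Definition tight_point (y : plane -> R) (z : 'I_k -> R) : point :=
  @mkpoint R k Q (\col_j y (enum_val j)) (fun i => const_mx (z i)).

Lemma weight_point y z u : weight (tight_point y z) u = y u.
Proof. by rewrite /weight mxE enum_rankK. Qed.

Lemma level_point y z i : level (tight_point y z) i = z i.
Proof. by rewrite /level stage2_mk mxE. Qed.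

Lemma stage1_weight (x : point) (j : 'I_#|{: plane}|) (c : 'I_1) :
  (stage1 x : 'cV_#|{: plane}|) j c = weight x (enum_val j).
Proof. by rewrite /weight enum_valK ord1. Qed.

Lemma tight_objective (x : point) :
  objective x = k.-1%:R / p%:R * (\sum_u weight x u) + \sum_(i < k) level x i.
Proof.
rewrite /objective /dotc; congr (_ + _).
  rewrite -(sum_enum_val (weight x)) mulr_sumr; apply: eq_bigr => j _.
  by rewrite stage1_weight !mxE fmorph_div !rmorph_nat.
by apply: eq_bigr => i _; rewrite big_ord1 -/(level x i) !mxE rmorph1 mul1r.
Qed.

Lemma tight_row (x : point) i (r : 'I_#|{: plane * plane}|) c :
  let: (u, v) := enum_val r in
  ((ratmx R (mxA2 Q i) *m stage1 x + ratmx R (mxB2 Q i) *m stage2 x i) r c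
    <= ratmx R (rhs2 Q i) r c) =
  (if line_class i u == line_class i v then level x i <= 1
   else weight x u + weight x v + level x i <= 2).
Proof.
case E : (enum_val r) => [u v].
rewrite ord1 [leLHS]mxE ![(_ *m _) _ _]mxE big_ord1 -/(level x i) !mxE E /= rmorph1 mul1r.
have -> : \sum_j ratmx R (mxA2 Q i) r j * stage1 x j 0 =
  \sum_w ((line_class i u != line_class i v) && ((w == u) || (w == v)))%:R * weight x w.
  rewrite -[RHS]sum_enum_val; apply: eq_bigr => j _.
  by rewrite stage1_weight !mxE E ratr_nat.
case: eqP => [_|/eqP uv] /=.
  by rewrite big1 ?add0r ?addr0 ?rmorph1 // => w _; rewrite mul0r.
(* The two points are distinct, so exactly two separate columns contribute to the row. *)
have {}uv : v != u by apply: contra uv => /eqP ->.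
rewrite (bigD1 u) //= (bigD1 v) //= !eqxx orbT big1 ?addr0 ?mul1r => [|w].
  by rewrite rmorphD rmorph1 -[1 + 1]/(2%:R).
by case/andP => /negPf -> /negPf ->; rewrite mul0r.
Qed.

Lemma tight_lpP (x : point) :
  lp_feasible R Q x <->
  [/\ forall u, 0 <= weight x u, forall i, 0 <= level x i,
      \sum_u weight x u <= p%:R
    & forall i u v, if line_class i u == line_class i v then level x i <= 1
                    else weight x u + weight x v + level x i <= 2].
Proof.
have budget r c : ((ratmx R (mxA Q) *m stage1 x) r c <= ratmx R (rhs1 Q) r c)
    = (\sum_u weight x u <= p%:R).
  rewrite !mxE ratr_nat -(sum_enum_val (weight x)); congr (_ <= _); apply: eq_bigr => j _.
  by rewrite stage1_weight !mxE rmorph1 mul1r.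
split=> [[y0 z0 A0 B0]|[y0 z0 A0 B0]]; split.
- by move=> u; have := y0 (enum_rank u) 0; rewrite mxE.
- by move=> i; have := z0 i 0 0; rewrite mxE.
- by rewrite -(budget 0 0).
- move=> i u v; have := tight_row x i (enum_rank (u, v)) 0.
  by rewrite enum_rankK => <-; apply: B0.
- by move=> j c; rewrite stage1_weight mxE.
- by move=> i j c; rewrite mxE !ord1; apply: z0.
- by move=> r c; rewrite budget.
- move=> i r c; have := tight_row x i r c; case: (enum_val r) => u v ->.
  exact: B0.
Qed.

Lemma tight_integral (x : point) :
  Defs.integral R Q x <->
  (forall u, weight x u \is a Num.int) /\ (forall i, level x i \is a Num.int).
Proof.
split=> -[H1 H2]; split.
- by move=> u; apply: H1; rewrite inE.
- by move=> i; apply: H2; rewrite inE.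
- by move=> j _; rewrite stage1_weight.
- by move=> i j _; rewrite ord1; apply: H2.
Qed.

(** * The integer optimum of the example *)

Lemma sum_weight_le1 (x : point) i j : feasible R Q x -> i != j ->
  1 <= level x i -> 1 <= level x j -> \sum_u weight x u <= 1.
Proof.
move=> [/tight_lpP[y0 _ _ H] /tight_integral[yI _]] ij zi zj.
(* Distinct points share a line of at most one of the classes [i] and [j]; the row of the other
   class, where $z \ge 1$, gives the bound. *)
have sep u v : u != v -> weight x u + weight x v <= 1.
  move=> uv; have := H i u v; have := H j u v.
  case: eqP => [ej|_]; last lra.
  case: eqP => [ei|_]; last lra.
  by rewrite (line_class_inj ij ei ej) eqxx in uv.
have [/existsP[u yu]|/existsPn y_eq0] := boolP [exists u, weight x u != 0]; last first.
  by rewrite big1 // => u _; have := y_eq0 u; rewrite negbK => /eqP.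
have yu1 : 1 <= weight x u by rewrite -(ger0_norm (y0 u)) norm_intr_ge1.
rewrite (bigD1 u) //= big1 ?addr0 => [|v vu].
  (* Any second point serves here: with its weight nonnegative, [sep] gives $y_u \le 1$. *)
  have /sep : u != (u.1, u.2 + 1).
    by apply/eqP => /(congr1 snd)/esym/eqP; rewrite -subr_eq0 addrAC subrr add0r oner_eq0.
  by have := y0 (u.1, u.2 + 1); lra.
by have := sep _ _ vu; have := y0 v; lra.
Qed.

(** If two of the $z_i$ are nonzero, the total weight is at most 1 and the value at most $k + (k -
    1)/p$. Otherwise the weight is at most $p$ and the value at most $(k - 1) + 1 = k$. *)
Lemma tight_feasible_le (x : point) : feasible R Q x ->
  objective x <= k%:R + k.-1%:R / p%:R.
Proof.
move=> Fx; have [/tight_lpP[y0 z0 B H] /tight_integral[_ zI]] := Fx.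
have p0 : 0 < p%:R :> R by rewrite ltr0n prime_gt0.
have c0 : 0 <= k.-1%:R / p%:R :> R by rewrite divr_ge0.
(* A pair of equal points gives the row $z_i \le 1$. *)
have z_le1 i : level x i <= 1 by have := H i 0 0; rewrite eqxx.
have z_ge1 i : level x i != 0 -> 1 <= level x i.
  by move=> zi; rewrite -(ger0_norm (z0 i)) norm_intr_ge1.
rewrite tight_objective.
have [/existsP[i /existsP[j /and3P[ij /z_ge1 zi /z_ge1 zj]]]|] :=
  boolP [exists i, exists j, [&& i != j, level x i != 0 & level x j != 0]].
  have y_le1 := sum_weight_le1 Fx ij zi zj.
  rewrite addrC lerD ?ler_piMr //.
  have -> : k%:R = \sum_(i < k) 1 :> R by rewrite sumr_const card_ord.
  exact: ler_sum.
move=> /existsPn none.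
have y_le : k.-1%:R / p%:R * (\sum_u weight x u) <= k.-1%:R.
  by rewrite mulrAC ler_pdivrMr // ler_wpM2l.
have -> : k%:R = k.-1%:R + 1 :> R by rewrite natr1 prednK.
suff : \sum_(i < k) level x i <= 1 by lra.
have [/existsP[i zi]|/existsPn z_eq0] := boolP [exists i, level x i != 0]; last first.
  by rewrite big1 // => i _; have := z_eq0 i; rewrite negbK => /eqP.
rewrite (bigD1 i) //= big1 ?addr0 // => j ji.
by have /existsPn/(_ j) := none i; rewrite eq_sym ji zi negbK => /eqP.
Qed.

(** A single point lies on one line of every class, so all $z_i$ can be 1 at once. *)
Definition integer_optimum : point := tight_point (fun u => (u == 0)%:R) (fun=> 1).

Lemma integer_optimum_feasible : feasible R Q integer_optimum.
Proof.
split; [apply/tight_lpP | apply/tight_integral]; split.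
- by move=> u; rewrite weight_point.
- by move=> i; rewrite level_point.
- under eq_bigr do rewrite weight_point.
  by rewrite (bigD1 (0 : plane)) //= big1 ?addr0 ?ler1n ?prime_gt0 // => u /negPf ->.
- move=> i u v; rewrite !weight_point level_point; case: eqP => // uv.
  have : (u == 0)%:R + (v == 0)%:R <= 1%:R :> R.
    rewrite -natrD ler_nat; case: eqP => [u0|//]; case: eqP => // v0.
    by rewrite u0 v0 in uv.
  lra.
- by move=> u; rewrite weight_point natr_int.
- by move=> i; rewrite level_point.
Qed.

Lemma integer_optimum_objective :
  objective integer_optimum = k%:R + k.-1%:R / p%:R.
Proof.
rewrite tight_objective.
under eq_bigr do rewrite weight_point.
under [X in _ + X]eq_bigr do rewrite level_point.
rewrite (bigD1 (0 : plane)) //= big1 ?addr0 ?mulr1 => [|u /negPf -> //].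
by rewrite sumr_const card_ord addrC.
Qed.

(** * The fractional optimum, which satisfies all specific-scenario cuts *)

Definition fractional_optimum : point := tight_point (fun=> p%:R^-1) (fun=> 1).

Lemma fractional_optimum_objective :
  objective fractional_optimum = 2 * k%:R - 1.
Proof.
have p0 : p%:R != 0 :> R by rewrite pnatr_eq0 -lt0n prime_gt0.
rewrite tight_objective.
under eq_bigr do rewrite weight_point.
under [X in _ + X]eq_bigr do rewrite level_point.
rewrite !sumr_const card_plane card_ord -[p%:R^-1 *+ _]mulr_natr natrM.
have -> : k%:R = k.-1%:R + 1 :> R by rewrite natr1 prednK.
by field.
Qed.

(** The budget limits the first stage to $k - 1$ and every $z_i$ is at most 1, so $2k - 1$ already
    bounds the relaxation. *)
Lemma tight_lp_le (x : point) : lp_feasible R Q x -> objective x <= 2 * k%:R - 1.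
Proof.
move=> /tight_lpP[y0 z0 B H].
have p0 : 0 < p%:R :> R by rewrite ltr0n prime_gt0.
have z_le : \sum_(i < k) level x i <= k%:R.
  have -> : k%:R = \sum_(i < k) 1 :> R by rewrite sumr_const card_ord.
  by apply: ler_sum => i _; have := H i 0 0; rewrite eqxx.
have y_le : k.-1%:R / p%:R * (\sum_u weight x u) <= k.-1%:R.
  by rewrite mulrAC ler_pdivrMr // ler_wpM2l.
rewrite tight_objective.
by have : k%:R = k.-1%:R + 1 :> R; [rewrite natr1 prednK | lra].
Qed.

Definition line_point i c : point :=
  tight_point (fun u => (line_class i u == c)%:R) (fun j => (j == i)%:R).

Lemma line_point_feasible i c : feasible R Q (line_point i c).
Proof.
split; [apply/tight_lpP | apply/tight_integral]; split.
- by move=> u; rewrite weight_point.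
- by move=> j; rewrite level_point.
- under eq_bigr do rewrite weight_point.
  by rewrite sum_line_class.
- move=> j u v; rewrite !weight_point level_point.
  have [_|uv] := eqVneq; first by rewrite lern1 leq_b1.
  rewrite -!natrD ler_nat; have [ji|_] := eqVneq j i; last by case: eqP; case: eqP.
  move: uv; rewrite ji; have [->|_] := eqVneq (line_class i u) c => //.
    by rewrite eq_sym => /negPf ->.
  by case: (_ == c).
- by move=> u; rewrite weight_point natr_int.
- by move=> j; rewrite level_point natr_int.
Qed.

Lemma tight_linform (a x : point) :
  linform a x = (\sum_u weight a u * weight x u) + \sum_(i < k) level a i * level x i.
Proof.
rewrite /linform /dotc -(sum_enum_val (fun u => weight a u * weight x u)).
congr (_ + _); first by apply: eq_bigr => j _; rewrite !stage1_weight.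
by apply: eq_bigr => i _; rewrite big_ord1.
Qed.

(** A cut for realization [i] sees only $y$ and $z_i$, and in these coordinates the point is the
    average of the $p$ points [line_point i c], each of which is feasible. *)
Lemma fractional_optimum_closure :
  specific_scenario_closure R Q fractional_optimum.
Proof.
have p2 : 2 <= p%:R :> R by rewrite ler_nat prime_gt1.
have p0 : p%:R != 0 :> R by rewrite pnatr_eq0 -lt0n prime_gt0.
split.
  apply/tight_lpP; split.
  - by move=> u; rewrite weight_point invr_ge0.
  - by move=> i; rewrite level_point.
  - under eq_bigr do rewrite weight_point.
    by rewrite sumr_const card_plane -[p%:R^-1 *+ _]mulr_natr natrM mulKf.
  - move=> i u v; rewrite !weight_point level_point; case: eqP => // _.
    (* The row $2/p + 1 \le 2$ needs $p \ge 2$. *)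
    have : p%:R^-1 <= 2^-1 :> R by rewrite lef_pV2 // posrE; lra.
    lra.
move=> a b [ab [i ai]].
have ai0 j : j != i -> level a j = 0 by move=> /ai; rewrite /level => ->; rewrite mxE.
have H c : linform a (line_point i c) <= b.
  exact: ab _ (feasible_hull (line_point_feasible i c)).
have level_sum x : \sum_(j < k) level a j * level x j = level a i * level x i.
  by rewrite (bigD1 i) //= big1 ?addr0 // => j ji; rewrite ai0 ?mul0r.
have : \sum_(c : 'F_p) linform a (line_point i c) <= \sum_(c : 'F_p) b by exact: ler_sum.
have -> : \sum_(c : 'F_p) linform a (line_point i c) = p%:R * linform a fractional_optimum.
  under eq_bigr do rewrite tight_linform level_sum level_point eqxx mulr1.
  rewrite tight_linform level_sum level_point mulr1 big_split /= sumr_const card_Fp //.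
  rewrite mulrDr [p%:R * level a i]mulr_natl; congr (_ + _).
  (* Each point lies on exactly one line of class [i], so after the exchange the inner sum has a
     single nonzero term. *)
  rewrite exchange_big mulr_sumr; apply: eq_bigr => u _; rewrite weight_point /=.
  under eq_bigr do rewrite weight_point.
  rewrite -mulr_sumr (bigD1 (line_class i u)) //= eqxx big1 => [|c cu].
    by rewrite addr0 mulrCA mulfV.
  by rewrite eq_sym (negPf cu).
rewrite sumr_const card_Fp // -[b *+ _]mulr_natl ler_pM2l //; lra.
Qed.

(** * The two optimal values of the example, both attained *)

Lemma tight_zI : zI R Q = (k%:R + k.-1%:R / p%:R)%:E.
Proof.
rewrite -integer_optimum_objective; apply: optval_max.
  exact: feasible_hull integer_optimum_feasible.
move=> x; rewrite objectiveE integer_optimum_objective.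
by apply: hull_linform_le => y; rewrite -objectiveE; apply: tight_feasible_le.
Qed.

Lemma tight_zI_attained : attained (integer_hull R Q).
Proof.
exists integer_optimum; first exact: feasible_hull integer_optimum_feasible.
by rewrite integer_optimum_objective -tight_zI.
Qed.

Lemma tight_zNS : zNS R Q = (2 * k%:R - 1)%:E.
Proof.
rewrite -fractional_optimum_objective; apply: optval_max.
  exact: fractional_optimum_closure.
by move=> x [/tight_lp_le]; rewrite fractional_optimum_objective.
Qed.

Lemma tight_zNS_attained : attained (specific_scenario_closure R Q).
Proof.
exists fractional_optimum; first exact: fractional_optimum_closure.
by rewrite fractional_optimum_objective -tight_zNS.
Qed.

End TightExample.

(** * Choice of $p$ and conclusion *)

Lemma tightness_ineq (R : realFieldType) (m p eps : R) :
  1 <= m -> 0 < p -> 0 < eps -> 2 * m <= eps * p ->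
  ((2 * m - 1) / m - eps) * (m + (m - 1) / p) <= 2 * m - 1.
Proof.
move=> m1 p0 eps0 big_p.
have -> : ((2 * m - 1) / m - eps) * (m + (m - 1) / p) =
  2 * m - 1 + ((2 * m - 1) * (m - 1) / m / p - eps * (m + (m - 1) / p)).
  by field; apply/andP; split; apply: lt0r_neq0; lra.
have d0 : 0 <= (m - 1) / p by apply: divr_ge0; lra.
(* Since $(2m - 1)(m - 1) \le 2m^2$, the left side is at most $2m/p \le eps \le eps \cdot m$. *)
suff : (2 * m - 1) * (m - 1) / m / p <= eps * m by nra.
rewrite !ler_pdivrMr //; last lra.
by nra.
Qed.

Theorem corollary16 (R : realType) (k : nat) (hk : (1 <= k)%N) :
  (forall Q : packing_problem k,
     (zNS R Q <= ((2 * k%:R - 1) / k%:R)%:E * zI R Q)%E) /\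
  (forall eps : R, 0 < eps ->
     exists Q : packing_problem k,
       [/\ attained (integer_hull R Q),
           attained (specific_scenario_closure R Q),
           (0 < zI R Q)%E
         & (((2 * k%:R - 1) / k%:R - eps)%:E * zI R Q <= zNS R Q)%E]).
Proof.
split=> [Q|eps eps0]; first exact: zNS_le.
(* $p > k$ keeps the slopes distinct, and $p \ge 2k/eps$ brings the ratio within [eps] of its
   limit. *)
have [p lt_p p_prime] := prime_above (maxn k (Num.truncn (2 * k%:R / eps))).
move: lt_p; rewrite gtn_max => /andP[/ltnW le_kp lt_p].
have kR : 1 <= k%:R :> R by rewrite ler1n.
have p0 : 0 < p%:R :> R by rewrite ltr0n prime_gt0.
have big_p : 2 * k%:R <= eps * p%:R.
  rewrite [leRHS]mulrC -ler_pdivrMr //; apply/ltW.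
  by apply: (lt_le_trans (truncnS_gt _)); rewrite ler_nat.
exists (tight_problem k p); split.
- exact: tight_zI_attained.
- exact: tight_zNS_attained.
- rewrite tight_zI // lte_fin; apply: ltr_wpDr; last lra.
  by rewrite divr_ge0.
rewrite tight_zI // tight_zNS // -EFinM lee_fin.
have kE : k.-1%:R = k%:R - 1 :> R by rewrite -[in RHS](prednK hk) -natr1 addrK.
rewrite kE; exact: tightness_ineq.
Qed.
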